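(* Let $n\ge 1$ be an integer and let $\lambda_1,\dots,\lambda_{n+1}$ be independent variables (commuting indeterminates). Then $$\sum_{\sigma\in S_{n+1}}\sum_{k=1}^n\frac{\lambda_{\sigma(1)}+\cdots+\lambda_{\sigma(k)}}{\lambda_{\sigma(k)}-\lambda_{\sigma(k+1)}}=\binom{n+1}{2}\,n!.$$
   Context: $S_{n+1}$ denotes the symmetric group of all permutations of $\{1,2,\dots,n+1\}$. The identity is one of rational functions (over $\mathbb{Q}$) in the indicated indeterminates. *)

(* Defs.v *)
From HB Require Import structures.
From mathcomp Require Export all_boot all_order all_fingroup all_algebra.
From mathcomp Require Export mpoly.

Set Implicit Arguments.
Unset Strict Implicit.
Unset Printing Implicit Defensive.

Import GRing.Theory.
Local Open Scope ring_scope.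

Notation ratfun n := {fraction {mpoly rat[n]}}.

(* Indeterminates are numbered from 0, i.e. [lambda i] is $\lambda_{i+1}$. *)
Definition lambda (n : nat) (i : 'I_n) : ratfun n :=
  tofrac ('X_i : {mpoly rat[n]}).

(* Main.v *)
(* For a fixed position k, precomposing the permutation with the transposition
   of k and k+1 negates the denominator a - b and replaces the numerator S + a
   by S + b; the two terms add up to 1. Summing over all permutations, each k
   contributes (n+1)!/2. *)
Require Import Defs.
From mathcomp Require Import ring.

Import GRing.Theory Num.Theory.
Local Open Scope ring_scope.

Lemma lambda_inj (n : nat) : injective (@lambda n).
Proof.
move=> i j /eqP; rewrite tofrac_eq => /eqP /(congr1 (mcoeff U_(i)%MM)).
rewrite !mcoeffXU eqxx; case: eqP => [-> //|_ /eqP].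
by rewrite oner_eq0.
Qed.

Lemma ratfun_natr_eq0 (n m : nat) : (m%:R == 0 :> ratfun n) = (m == 0)%N.
Proof.
by rewrite -[m%:R](rmorph_nat (@tofrac _)) tofrac_eq0 -mpolyC_nat
  mpolyC_eq0 pnatr_eq0.
Qed.

Lemma sum_prefix_tperm (F : fieldType) (n : nat) (x : 'I_n.+1 -> F)
    (p q : 'I_n.+1) (s : 'S_n.+1) : injective x -> q = p.+1 :> nat ->
  let f (u : 'S_n.+1) :=
    (\sum_(i < n.+1 | (i <= p)%N) x (u i)) / (x (u p) - x (u q)) in
  f s + f (tperm p q * s)%g = 1.
Proof.
move=> x_inj qE /=.
have neq_pq : p != q by rewrite -val_eqE /= qE neq_ltn leqnn.
have dne : x (s p) - x (s q) != 0.
  by rewrite subr_eq0 (inj_eq x_inj) (inj_eq perm_inj).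
have dne' : x (s q) - x (s p) != 0 by rewrite -opprB oppr_eq0.
rewrite !permM tpermL tpermR (bigD1 p) //= [in X in _ + X](bigD1 p) //=.
rewrite permM tpermL.
(* Positions below [p] are fixed by the transposition, so both numerators share the same remaining
   sum. *)
under [in X in _ + X]eq_bigr => i /andP[le_ip neq_ip].
  rewrite permM tpermD 1?eq_sym //; first over.
  by apply: contraTneq le_ip => ->; rewrite qE -ltnNge.
by field; rewrite dne dne'.
Qed.

Lemma sum_perm_prefix (F : fieldType) (n : nat) (x : 'I_n.+1 -> F)
    (p q : 'I_n.+1) : injective x -> q = p.+1 :> nat ->
  (\sum_(s : 'S_n.+1)
     (\sum_(i < n.+1 | (i <= p)%N) x (s i)) / (x (s p) - x (s q))) *+ 2
  = (n.+1)`!%:R.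
Proof.
move=> x_inj qE; rewrite mulr2n.
(* Only the second copy of the sum is reindexed, so each [s] meets its transposed partner. *)
rewrite [X in _ + X](reindex_inj (mulgI (tperm p q))) -big_split /=.
under eq_bigr => s _ do rewrite (sum_prefix_tperm _ _ _ _ _ s x_inj qE).
by rewrite sumr_const -card_Sn.
Qed.

(* Positions and variables are numbered from 0: the summation index [k : 'I_n]
   is $k - 1$, [widen_ord (leqnSn n) k] is the k-th position, [lift ord0 k] the
   (k+1)-st. *)
Theorem corollary2 (n : nat) (hn : (1 <= n)%N) :
  \sum_(s : 'S_n.+1) \sum_(k < n)
     (\sum_(i < n.+1 | (i <= k)%N) lambda (s i))
       / (lambda (s (widen_ord (leqnSn n) k)) - lambda (s (lift ord0 k)))
  = ('C(n.+1, 2) * n`!)%:R :> ratfun n.+1.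
Proof.
have two_neq0 : 2%:R != 0 :> ratfun n.+1 by rewrite ratfun_natr_eq0.
(* After doubling, each position [k] contributes exactly $(n+1)!$. *)
apply: (mulIf two_neq0); rewrite -natrM exchange_big /= mulr_natr -sumrMnl.
under eq_bigr => k _.
  rewrite (sum_perm_prefix _ _ _ (widen_ord (leqnSn n) k) (lift ord0 k)
             (lambda_inj _)) //; over.
rewrite sumr_const card_ord -mulrnA; congr _%:R.
(* Reading 2 as $2!$ turns $\binom{n+1}{2}\cdot 2$ into the falling factorial $(n+1)n$. *)
by rewrite mulnAC -[(2)%N]/(2`!) bin_ffact ffactnS ffactn1 factS mulnAC.
Qed.
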